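(* Let $f:\mathbb{R}^d\to\mathbb{R}$ be differentiable, bounded from below and $L$-smooth. Let $\mathcal{D}$ be a probability distribution on $\mathbb{R}^d$ such that (i) $\mathbb{E}_{s\sim\mathcal{D}}[\|s\|_2^2]<\infty$; (ii) there are a norm $\|\cdot\|_{\mathcal{D}}$ on $\mathbb{R}^d$ and a constant $\mu_{\mathcal{D}}>0$ with $\mathbb{E}_{s\sim\mathcal{D}}|\langle v,s\rangle|\ge\mu_{\mathcal{D}}\|v\|_{\mathcal{D}}$ for all $v\in\mathbb{R}^d$; (iii) $\mathbb{P}_{s\sim\mathcal{D}}(\|s\|_2\le 1)=1$. Let $\{\theta^t\}_{t\ge1}$ be generated by the Stochastic Three Points (STP) algorithm with (deterministic, positive) step sizes $\{\alpha_t\}_{t\ge1}$ satisfying $\sum_{t=1}^\infty\alpha_t^2<\infty$ and $\sum_{t=1}^\infty\alpha_t=\infty$. Then, as $T\to\infty$, $$\min_{1\le t\le T}\|\nabla f(\theta^t)\|_{\mathcal{D}}=o\left(\frac{1}{\sum_{t=1}^T\alpha_t}\right)\quad\text{almost surely.}$$ In particular, if $\alpha_t=\frac{\alpha}{t^{\frac12+\epsilon}}$ with $\alpha>0$ and $\epsilon\in(0,\frac12)$, then $$\min_{1\le t\le T}\|\nabla f(\theta^t)\|_{\mathcal{D}}=o\left(\frac{1}{T^{\frac12-\epsilon}}\right)\quad\text{almost surely.}$$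
   Context: $L$-smooth means $\|\nabla f(x)-\nabla f(y)\|_2\le L\|x-y\|_2$ for all $x,y\in\mathbb{R}^d$. STP algorithm: given a deterministic initial point $\theta^1\in\mathbb{R}^d$, step sizes $\alpha_t>0$ and the distribution $\mathcal{D}$, for $t=1,2,\ldots$ draw a random vector $s_t\sim\mathcal{D}$ (the $s_t$ being independent) and set $\theta^{t+1}\in\arg\min_{\theta\in\{\theta^t,\ \theta^t+\alpha_ts_t,\ \theta^t-\alpha_ts_t\}}f(\theta)$, with ties broken by a fixed measurable rule depending only on $(t,\theta^t,s_t)$. *)

(* Defs.v *)
From HB Require Import structures.
From mathcomp Require Import all_boot all_order all_algebra finmap.
From mathcomp Require Import all_classical all_reals all_analysis.

Set Implicit Arguments.
Unset Strict Implicit.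
Unset Printing Implicit Defensive.

Import Order.TTheory GRing.Theory Num.Theory.
Import numFieldNormedType.Exports.

Local Open Scope classical_set_scope.
Local Open Scope ring_scope.

(** The library provides no sigma-algebra on row vectors: [borel_rV R d] is
    ['rV[R]_d] (convertibly) with the sigma-algebra generated by its open
    sets. The library's norm and topology on ['rV[R]_d] are those of the
    sup norm, hence the separate Euclidean norm [enorm] below. *)
Definition borel_rV (R : realType) (d : nat) :=
  g_sigma_algebraType (@open 'rV[R]_d).

Section euclidean.
Context {R : realType} {d : nat}.
Implicit Types (x v s : 'rV[R]_d) (f : 'rV[R]_d -> R).

Definition dotp v s : R := \sum_(i < d) v ord0 i * s ord0 i.

Definition enorm x : R := Num.sqrt (dotp x x).

Definition grad f x : 'rV[R]_d := \row_(i < d) 'D_(delta_mx ord0 i) f x.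

Definition smooth (L : R) f :=
  forall x y, enorm (grad f x - grad f y) <= L * enorm (x - y).

(** Nonnegativity and [N 0 = 0] follow from the three fields. *)
Record is_norm (N : 'rV[R]_d -> R) : Prop := {
  is_norm_triangle : forall x y, N (x + y) <= N x + N y ;
  is_norm_scale : forall (a : R) x, N (a *: x) = `|a| * N x ;
  is_norm_definite : forall x, N x = 0 -> x = 0 }.

End euclidean.

Definition argmin {R : realType} {T : Type} (f : T -> R) (S : set T) : set T :=
  [set x | S x /\ forall y, S y -> f x <= f y].

(** Mutual independence of the subfamily of [X] indexed by [I]. *)
Definition mutually_independent {dO d' : measure_display}
    {Omega : measurableType dO} {T' : measurableType d'} {R : realType}
    (P : probability Omega R) (I : set nat) (X : nat -> {RV P >-> T'}) :=
  forall (J : {fset nat}) (A : nat -> set T'),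
    [set` J] `<=` I -> (forall t, measurable (A t)) ->
    P (\bigcap_(t in [set` J]) (X t @^-1` A t)) =
    (\prod_(t <- J) P (X t @^-1` A t))%E.

(** The trajectory [theta] is produced by the Stochastic Three Points method.
    Time starts at [1]: [alpha 0], [s 0] and [theta 0] are never used.
    [step t (x, u)] is the minimizer selected from the current point [x] and
    the direction [u]; as a measurable function of [(x, u)] only, it
    incorporates the measurable rule breaking ties. *)
Record is_STP {R : realType} {d : nat} (f : 'rV[R]_d -> R) (alpha : nat -> R)
    (D : probability (borel_rV R d) R)
    {dO : measure_display} {Omega : measurableType dO}
    (P : probability Omega R) (s : nat -> {RV P >-> borel_rV R d})
    (theta : nat -> Omega -> 'rV[R]_d) : Prop := {
  STP_law : forall t, (0 < t)%N ->
    forall A, measurable A -> distribution P (s t) A = D A ;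
  STP_indep : mutually_independent [set t | (0 < t)%N] s ;
  STP_init : exists theta1, forall w, theta 1%N w = theta1 ;
  STP_step : exists step : nat -> borel_rV R d * borel_rV R d -> borel_rV R d,
    [/\ forall t, (0 < t)%N -> measurable_fun [set: _] (step t),
        forall t (x u : 'rV[R]_d), (0 < t)%N ->
          argmin f [set x; x + alpha t *: u; x - alpha t *: u]
            (step t (x, u)) &
        forall t w, (0 < t)%N -> theta t.+1 w = step t (theta t w, s t w)] }.

(** Minimum of [u 1, ..., u T]; the default value [u 1] only matters for
    [T = 0]. *)
Definition running_min {R : realType} (u : nat -> R) (T : nat) : R :=
  \big[Num.min/u 1%N]_(1 <= t < T.+1) u t.

(* Main.v *)
Require Import Defs.
From HB Require Import structures.
From mathcomp Require Import all_boot all_order all_algebra finmap lra.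
From mathcomp Require Import all_classical all_reals all_analysis.
From mathcomp Require Import measurable_realfun.

Set Implicit Arguments.
Unset Strict Implicit.
Unset Printing Implicit Defensive.

Import Order.TTheory GRing.Theory Num.Theory.
Import numFieldNormedType.Exports.

Local Open Scope classical_set_scope.
Local Open Scope ring_scope.

(** Write [g_t] for the gradient of [f] at [theta t]. By smoothness one STP step
    decreases [f] by at least [alpha_t |<g_t, s_t>| - M alpha_t^2 ||s_t||^2],
    so telescoping bounds [sum_t alpha_t |<g_t, s_t>|] in expectation, since [f]
    is bounded below and [sum_t alpha_t^2] converges. The point [theta t] depends
    only on [s_1, ..., s_(t-1)], hence is independent of [s_t], and by Tonelli
    [E |<g_t, s_t>| >= muD E (N g_t)]; therefore [sum_t alpha_t N(g_t)] converges
    almost surely. As the weights have infinite total mass and the running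
    minimum is nonincreasing, [(S_n - S_k) min_{t <= n} N(g_t)] is at most a tail
    of this series, which forces the minimum to be [o(1 / S_n)]. *)

(** * Euclidean geometry, smoothness and the decrease achieved by one step *)

Section euclidean.
Context {R : realType} {d : nat}.
Implicit Types (x v h : 'rV[R]_d) (f : 'rV[R]_d -> R).

Lemma dotp_ge0 x : 0 <= dotp x x.
Proof. by apply: sumr_ge0 => i _; rewrite -expr2 sqr_ge0. Qed.

Lemma enorm_ge0 x : 0 <= enorm x.
Proof. exact: sqrtr_ge0. Qed.

Lemma sqr_enorm x : enorm x ^+ 2 = dotp x x.
Proof. by rewrite sqr_sqrtr// dotp_ge0. Qed.

Lemma dotpZr a v h : dotp v (a *: h) = a * dotp v h.
Proof. by rewrite /dotp mulr_sumr; apply: eq_bigr => i _; rewrite mxE mulrCA. Qed.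

Lemma dotpBl v w h : dotp (v - w) h = dotp v h - dotp w h.
Proof.
by rewrite /dotp -sumrB; apply: eq_bigr => i _; rewrite !mxE mulrBl.
Qed.

Lemma sqr_enormZ a x : enorm (a *: x) ^+ 2 = a ^+ 2 * enorm x ^+ 2.
Proof.
rewrite !sqr_enorm /dotp mulr_sumr; apply: eq_bigr => i _.
by rewrite mxE -!expr2 exprMn.
Qed.

(** Young's inequality, coordinate by coordinate. It stands in for Cauchy-Schwarz at the price of a
    larger constant in the descent inequality. *)
Lemma dotp_le_sqr v h : dotp v h <= (enorm v ^+ 2 + enorm h ^+ 2) / 2.
Proof.
rewrite !sqr_enorm /dotp -big_split/= mulr_suml; apply: ler_sum => i _.
have := sqr_ge0 (v ord0 i - h ord0 i); nra.
Qed.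

Lemma coord_le_enorm x i : `|x ord0 i| <= enorm x.
Proof.
rewrite -(@ler_sqr _ `|_|) ?nnegrE ?enorm_ge0// sqr_enorm real_normK ?num_real//.
rewrite /dotp (bigD1 i)//= -expr2 lerDl.
by apply: sumr_ge0 => j _; rewrite -expr2 sqr_ge0.
Qed.

Lemma continuous_sqr_enorm : continuous (fun x => enorm x ^+ 2).
Proof.
rewrite (_ : (fun x => _) = fun x => \sum_(i < d) x ord0 i * x ord0 i); last first.
  by apply/funext => x; rewrite sqr_enorm.
apply: continuous_big => [|i _ x]; first exact: add_continuous.
by have xc := @coord_continuous R 1 d ord0 i x; exact: (cvgM xc xc).
Qed.

Lemma continuous_enormB x : continuous (fun y : 'rV[R]_d => enorm (x - y)).
Proof.
have sqrc : continuous (fun y : 'rV[R]_d => dotp (x - y) (x - y)).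
  rewrite (_ : (fun y : 'rV[R]_d => _) = fun y : 'rV[R]_d =>
      \sum_(i < d) (x ord0 i - y ord0 i) * (x ord0 i - y ord0 i)); last first.
    by apply/funext => y; apply: eq_bigr => i _; rewrite !mxE.
  apply: continuous_big => [|i _ y]; first exact: add_continuous.
  have yi : {for y, continuous (fun y : 'rV[R]_d => x ord0 i - y ord0 i)}.
    exact: (cvgB (cvg_cst (x ord0 i)) (@coord_continuous R 1 d ord0 i y)).
  exact: (cvgM yi yi).
by move=> y; exact: (continuous_comp (sqrc y) (@sqrt_continuous _ _)).
Qed.

Lemma diff_grad f x h : differentiable f x -> 'd f x h = dotp (grad f x) h.
Proof.
move=> fx; rewrite [in LHS](row_sum_delta h) linear_sum/=; apply: eq_bigr => i _.
by rewrite linearZ/= mxE deriveE// mulrC.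
Qed.

(** A coordinate is dominated by the Euclidean norm, so its variation is at most
    [L * enorm (x - y)], which tends to 0 as [y] tends to [x]. Measurability of the gradient rests
    on this. *)
Lemma continuous_grad_coord L f i :
  smooth L f -> continuous (fun x => grad f x ord0 i).
Proof.
move=> fL x; apply/(@cvgrPdist_le _ _ _ (nbhs x)) => e e0.
have : {for x, continuous (fun y : 'rV[R]_d => L * enorm (x - y))}.
  exact: (cvgM (cvg_cst L) (@continuous_enormB x x)).
rewrite /prop_for /continuous_at subrr [enorm 0](_ : _ = 0); last first.
  by rewrite /enorm /dotp big1 ?sqrtr0// => j _; rewrite mxE mul0r.
rewrite mulr0 => /(@cvgrPdist_le _ _ _ (nbhs x)) /(_ e e0); apply: filterS => y.
rewrite sub0r normrN => /(le_trans (ler_norm _)); apply: le_trans.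
apply: le_trans (fL x y); apply: le_trans (coord_le_enorm _ i).
by rewrite !mxE.
Qed.

(** The mean value theorem on the segment gives a point where the gradient accounts for the whole
    increment. Its deviation from [grad f x] is paired with [h] by Young's inequality, whence
    [(L ^+ 2 + 1) / 2] instead of the usual [L / 2]; only the finiteness of this constant
    matters. *)
Lemma smooth_descent L f x h : (forall y, differentiable f y) -> smooth L f ->
  f (x + h) <= f x + dotp (grad f x) h + (L ^+ 2 + 1) / 2 * enorm h ^+ 2.
Proof.
move=> fdiff fL.
pose line : R -> 'rV[R]_d := cst x + ( *:%R ^~ h).
have lineE t : line t = x + t *: h by [].
have dline (t : R) : is_diff t line ( *:%R ^~ h).
  exact: (is_diff_eq (is_diffD (is_diff_cst x t) (is_diff_scalel t h)) (add0r _)).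
have dphi (t : R) : is_derive t 1 (f \o line) (dotp (grad f (line t)) h).
  have [ld lE] := dline t.
  split; first by apply/derivable1_diffP; exact: differentiable_comp.
  rewrite deriveE; last exact: differentiable_comp.
  by rewrite diff_comp//= lE scale1r diff_grad.
have cphi : {within `[0, 1], continuous (f \o line)}.
  apply: continuous_subspaceT => t; apply: differentiable_continuous.
  by apply: differentiable_comp => //; have [] := dline t.
have [c] := MVT ltr01 (fun t _ => dphi t) cphi.
rewrite in_itv/= => /andP[c0 c1].
rewrite /= !lineE scale1r scale0r addr0 subr0 mulr1 => /eqP.
rewrite subr_eq => /eqP ->; rewrite -lineE.
have : dotp (grad f (line c) - grad f x) h <= (L ^+ 2 + 1) / 2 * enorm h ^+ 2.
  apply: le_trans (dotp_le_sqr _ _) _; rewrite mulrAC ler_wpM2r ?invr_ge0//.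
  rewrite mulrDl mul1r lerD2r.
  have := fL (line c) x; rewrite [line c]lineE [_ - x]addrAC subrr add0r -lineE => gL.
  have : enorm (grad f (line c) - grad f x) ^+ 2 <= (L * enorm (c *: h)) ^+ 2.
    (* [L * enorm (c *: h)] is nonnegative because, by [gL], it dominates a norm. *)
    by rewrite ler_sqr ?nnegrE ?enorm_ge0// (le_trans _ gL) ?enorm_ge0.
  move=> /le_trans; apply; rewrite exprMn sqr_enormZ ler_wpM2l ?sqr_ge0//.
  by rewrite ler_piMl ?sqr_ge0// expr_le1// ltW.
by rewrite dotpBl; lra.
Qed.

(** Of the two trial points, one moves against the sign of the inner product and gains [a] times its
    absolute value; the quadratic error is the same for both. *)
Lemma argmin_descent L f a x u y : (forall z, differentiable f z) -> smooth L f ->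
  0 <= a -> argmin f [set x; x + a *: u; x - a *: u] y ->
  a * `|dotp (grad f x) u| + f y <=
    f x + (L ^+ 2 + 1) / 2 * (a ^+ 2 * enorm u ^+ 2).
Proof.
move=> fdiff fL a0 [_ miny].
have yp : f y <= f (x + a *: u) by apply: miny; left; right.
have ym : f y <= f (x + (- a) *: u) by rewrite scaleNr; apply: miny; right.
have := smooth_descent x (a *: u) fdiff fL.
have := smooth_descent x ((- a) *: u) fdiff fL.
rewrite !sqr_enormZ sqrrN !dotpZr => m p.
have [g0|g0] := leP 0 (dotp (grad f x) u).
  by rewrite ger0_norm//; lra.
by rewrite ltr0_norm//; lra.
Qed.

End euclidean.

(** * Borel measurability and uniqueness of measures on products *)

Lemma measurable_borel_rV (R : realType) d (g : 'rV[R]_d -> R) :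
  continuous g -> measurable_fun [set: borel_rV R d] (g : borel_rV R d -> R).
Proof.
move=> gc; apply: (measurability _ (RGenOInfty.measurableE R)) => //.
move=> _ [_ [x ->] <-]; rewrite setTI; apply: sub_sigma_algebra.
by apply: open_comp => [y _|]; [exact: gc|exact: interval_open].
Qed.

Definition pushforward_measure d1 d2 (T1 : measurableType d1)
    (T2 : measurableType d2) (R : realType) (m : {measure set T1 -> \bar R})
    (g : T1 -> T2) (mg : measurable_fun setT g) : {measure set T2 -> \bar R} :=
  @measure_function_pushforward__canonical__measure_function_Measure
    _ _ _ _ _ m _ mg.

Section rectangles.
Context d1 d2 (T1 : measurableType d1) (T2 : measurableType d2) (R : realType).
Local Open Scope ereal_scope.

(** Rectangles are stable under intersection, generate the product sigma-algebra and include the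
    whole space, so a finite measure is determined by them. *)
Lemma eq_finite_measure_rectangle (m1 m2 : {measure set (T1 * T2) -> \bar R}) :
  m1 setT < +oo ->
  (forall A B, measurable A -> measurable B -> m1 (A `*` B) = m2 (A `*` B)) ->
  forall X, measurable X -> m1 X = m2 X.
Proof.
move=> m1oo m12; apply: (measure_unique
    [set A `*` B | A in measurable & B in measurable] (fun=> setT)) => //.
- by rewrite measurable_prod_measurableType.
- move=> _ _ [A1 mA1 [B1 mB1 <-]] [A2 mA2 [B2 mB2 <-]]; rewrite -setXI.
  exists (A1 `&` A2); first exact: measurableI.
  by exists (B1 `&` B2); first exact: measurableI.
- by move=> _; exists setT => //; exists setT => //; rewrite setXTT.
- by rewrite bigcup_const//; exists 0%N.
- by move=> _ [A mA [B mB <-]]; exact: m12.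
Qed.

End rectangles.

(** * Independence of the current iterate from the present and future directions *)

Section iterated_random_functions.
Context d (T : measurableType d) dO (Omega : measurableType dO) (R : realType).
Variables (P : probability Omega R) (D : probability T R).
Variables (s : nat -> {RV P >-> T}) (step : nat -> T * T -> T).
Variables (theta : nat -> Omega -> T).
Hypothesis slaw : forall t, (0 < t)%N ->
  forall A, measurable A -> distribution P (s t) A = D A.
Hypothesis sindep : mutually_independent [set t | (0 < t)%N] s.
Hypothesis mstep : forall t, (0 < t)%N -> measurable_fun setT (step t).
Hypothesis theta1 : exists x, forall w, theta 1%N w = x.
Hypothesis thetaS :
  forall t w, (0 < t)%N -> theta t.+1 w = step t (theta t w, s t w).
Local Open Scope ereal_scope.

Let joint t w := (theta t w, s t w).

Lemma measurable_iterate t : (0 < t)%N -> measurable_fun setT (theta t).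
Proof.
case: t => // t _; elim: t => [|t IH].
  have [x xE] := theta1; rewrite (_ : theta 1%N = cst x); last exact/funext.
  exact: measurable_cst.
rewrite (_ : theta _ = step t.+1 \o joint t.+1); last first.
  by apply/funext => w; rewrite thetaS.
apply: measurableT_comp; first exact: mstep.
exact: measurable_fun_pair.
Qed.

Let measurable_joint t : (0 < t)%N -> measurable_fun setT (joint t).
Proof. by move=> t0; apply: measurable_fun_pair => //; exact: measurable_iterate. Qed.

Let measurable_preim (Y : {RV P >-> T}) A : measurable A -> measurable (Y @^-1` A).
Proof. by move=> mA; rewrite -[X in measurable X]setTI; exact: measurable_funPT. Qed.

Let event (J : {fset nat}) (B : nat -> set T) :=
  \bigcap_(j in [set` J]) (s j @^-1` B j).

Let measurable_event J B : (forall j, measurable (B j)) -> measurable (event J B).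
Proof.
move=> mB; apply: bigcap_measurableType => j _; exact: measurable_preim.
Qed.

(** Overriding [B] at the fresh index [t] by [C] gives the extra constraint the same shape as the
    others, so mutual independence splits off its factor. *)
Let event_cons t J C B : t \notin J -> (0 < t)%N ->
  (forall j, j \in J -> (0 < j)%N) -> measurable C -> (forall j, measurable (B j)) ->
  exists B', [/\ forall j, measurable (B' j),
    s t @^-1` C `&` event J B = event (t |` J)%fset B' &
    P (event (t |` J)%fset B') = P (s t @^-1` C) * P (event J B)].
Proof.
move=> tJ t0 J0 mC mB; pose B' j := if j == t then C else B j.
have B'J j : j \in J -> B' j = B j.
  by move=> jJ; rewrite /B' ifN//; apply: contraNneq tJ => <-.
have mB' j : measurable (B' j) by rewrite /B'; case: ifP.
exists B'; split => //.
- rewrite /event set_fsetU set_fset1 bigcap_setU bigcap_set1 /B' eqxx; congr (_ `&` _).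
  by apply: eq_bigcapr => j jJ; rewrite -[in LHS]B'J.
- rewrite /event !sindep//.
  + rewrite big_fsetU1//= {1}/B' eqxx; congr (_ * _).
    by apply: eq_big_seq => j jJ; rewrite B'J.
  + by move=> j /=; rewrite in_fset1U => /predU1P[->//|]; exact: J0.
Qed.

(* Carrying the directions of all later times [j >= t] makes the induction on
   [t] go through: [theta t.+1] is a function of [(theta t, s t)]. *)
Lemma iterate_independent_future t J B A : (0 < t)%N ->
  (forall j, j \in J -> (t <= j)%N) -> (forall j, measurable (B j)) -> measurable A ->
  P (theta t @^-1` A `&` event J B) = P (theta t @^-1` A) * P (event J B).
Proof.
case: t => // t _; elim: t J B A => [|t IH] J B A tJ mB mA.
  (* The initial point is deterministic: its preimages are the whole space or empty, and both are
     independent of everything. *)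
  have [x xE] := theta1; rewrite (_ : theta 1%N = cst x); last exact/funext.
  rewrite preimage_cst; case: ifP => _; first by rewrite setTI probability_setT mul1e.
  by rewrite set0I measure0 mul0e.
have tJ' : t.+1 \notin J by apply/negP => /tJ; rewrite ltnn.
have J0 j : j \in J -> (0 < j)%N by move/tJ; exact: leq_ltn_trans.
have mE : measurable (event J B) by exact: measurable_event.
have mtheta C : measurable C -> measurable (theta t.+1 @^-1` C).
  by move=> mC; rewrite -[X in measurable X]setTI; exact: measurable_iterate.
have PEfin : P (event J B) \is a fin_num by exact: fin_num_measure.
have PE0 : (0 <= fine (P (event J B)))%R by exact/fine_ge0/measure_ge0.
have mj := measurable_joint (ltn0Sn t).
(* The set pulled back by [step] need not be a rectangle, so the claim becomes an equality of
   measures: the law of the pair restricted to the future event, against the same law scaled by the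
   probability of that event. *)
pose m1 : {measure set (T * T) -> \bar R} := pushforward_measure (mrestr P mE) mj.
pose m2 : {measure set (T * T) -> \bar R} :=
  mscale (NngNum PE0) (pushforward_measure P mj).
have m12 X : measurable X -> m1 X = m2 X.
  apply: eq_finite_measure_rectangle.
    rewrite /m1/= /pushforward /mrestr preimage_setT setTI.
    by rewrite ltey_eq PEfin.
  move=> {}X Y mX mY.
  rewrite /m1 /m2/= /pushforward /mscale /mrestr/= fineK//.
  rewrite -[pushforward P _ _]/(P (theta t.+1 @^-1` X `&` s t.+1 @^-1` Y)).
  rewrite -[_ @^-1` _]/(theta t.+1 @^-1` X `&` s t.+1 @^-1` Y).
  (* On a rectangle the induction hypothesis is used twice: with [s t.+1] adjoined to the future
     directions, then with [s t.+1] alone. Comparing the two products isolates the factor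
     [P (event J B)]. *)
  have [B' [mB' B'E PB']] := event_cons tJ' (ltn0Sn t) J0 mY mB.
  rewrite -setIA B'E IH//; last first.
    by move=> j; rewrite in_fset1U => /predU1P[->//|/tJ/ltnW].
  have [B0 [mB0 B0E PB0]] := @event_cons t.+1 fset0 Y (fun=> setT) isT isT
    (fun j (jin : j \in fset0) => ltac:(by [])) mY (fun=> measurableT).
  have E0 : event fset0 (fun=> setT) = setT.
    by rewrite /event set_fset0 bigcap_set0.
  rewrite E0 setIT in B0E; rewrite E0 probability_setT mule1 in PB0.
  rewrite B0E IH//; last first.
    by move=> j; rewrite in_fset1U => /predU1P[->//|].
  by rewrite PB' PB0 muleA muleC.
have preimE : theta t.+2 @^-1` A = joint t.+1 @^-1` (step t.+1 @^-1` A).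
  by apply/seteqP; split => w /=; rewrite thetaS.
rewrite preimE.
have := m12 (step t.+1 @^-1` A).
rewrite /m1 /m2/= /pushforward /mscale /mrestr/= fineK// => ->; first by rewrite muleC.
by rewrite -[X in measurable X]setTI; exact: mstep.
Qed.

(** By independence the law of the pair is the product of the law of [theta t] and [D]; Tonelli then
    integrates over the direction first. *)
Lemma integral_iterate_step t (phi : T * T -> \bar R) : (0 < t)%N ->
  measurable_fun [set: T * T] phi -> (forall z, 0 <= phi z) ->
  \int[P]_w phi (theta t w, s t w) = \int[P]_w \int[D]_u phi (theta t w, u).
Proof.
move=> t0 mphi phi0.
have mt := measurable_iterate t0; have mj := measurable_joint t0.
have indep A B : measurable A -> measurable B ->
    pushforward P (joint t) (A `*` B) = pushforward P (theta t) A * D B.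
  move=> mA mB; rewrite -(slaw t0)// /distribution /pushforward.
  (* The family of future directions is here reduced to the single time [t]. *)
  have := @iterate_independent_future t [fset t]%fset (fun=> B) A t0.
  rewrite /event set_fset1 bigcap_set1 => <- //.
  by move=> j; rewrite in_fset1 => /eqP ->.
pose X : {mfun Omega >-> T} := HB.pack (theta t) (isMeasurableFun.Build _ _ _ _ _ mt).
pose Z : {mfun Omega >-> (T * T)%type} :=
  HB.pack (joint t) (isMeasurableFun.Build _ _ _ _ _ mj).
transitivity (\int[distribution P Z]_z phi z).
  by rewrite ge0_integral_distribution.
transitivity (\int[distribution P X \x D]_z phi z).
  apply: eq_measure_integral => A mA _; apply/esym.
  exact: (@product_measure_unique _ _ _ _ _ (distribution P X) D
    (distribution P Z) indep A mA).
rewrite (@fubini_tonelli1 _ _ _ _ _ (distribution P X) D phi)//.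
rewrite ge0_integral_distribution//.
- exact: measurable_fun_fubini_tonelli_F.
- by move=> x; apply: integral_ge0.
Qed.

End iterated_random_functions.

(** * Running minima of weighted summable sequences, and sums of powers *)

Section running_minimum.
Context {R : realType}.
Implicit Types (a u : nat -> R).

Lemma running_min_le u T t : (0 < t <= T)%N -> running_min u T <= u t.
Proof.
by move=> tT; apply: (@ge_bigmin_seq _ _ _ _ _ t); rewrite // mem_index_iota.
Qed.

Lemma running_min_ge0 u T : (forall t, (0 < t)%N -> 0 <= u t) -> 0 <= running_min u T.
Proof.
move=> u0; rewrite /running_min big_nat.
by apply: le_bigmin => [|t /andP[t0 _]]; exact: u0.
Qed.

(** Boundedness of the weighted sums makes their tails small, while divergence of the weights makes
    any fixed initial mass negligible. *)
Lemma running_min_littleo a u C :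
  (forall t, (0 < t)%N -> 0 < a t) -> (forall t, (0 < t)%N -> 0 <= u t) ->
  (forall n, \sum_(1 <= t < n.+1) a t * u t <= C) ->
  (forall A, \forall n \near \oo, A <= \sum_(1 <= t < n.+1) a t) ->
  running_min u =o_\oo (fun T => (\sum_(1 <= t < T.+1) a t)^-1).
Proof.
move=> a0 u0 auC aoo; apply/eqoP => e e0.
pose S n := \sum_(1 <= t < n.+1) a t; pose B n := \sum_(1 <= t < n.+1) a t * u t.
have BS n k : (k <= n)%N -> (S n - S k) * running_min u n <= B n - B k.
  move=> kn.
  rewrite /S /B !(@big_cat_nat _ _ _ k.+1 1 n.+1)//= ![_ + _ - _]addrAC !subrr !add0r.
  rewrite mulr_suml !big_nat; apply: ler_sum => t /andP[kt tn].
  have t0 : (0 < t)%N by exact: leq_ltn_trans kt.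
  by rewrite ler_wpM2l ?(ltW (a0 _ t0))// running_min_le// t0.
have supB : has_sup (range B).
  by split; [exists (B 0%N), 0%N|exists C => _ [n _ <-]; exact: auC].
have e20 : 0 < e / 2 by rewrite divr_gt0.
(* From this [k] on, no increment [B n - B k] exceeds [e / 2]. *)
have [_ [k _ <-] Bk] := sup_adherent e20 supB.
near=> n.
have kn : (k <= n)%N by near: n; exact: nbhs_infty_ge.
(* Then [S n - S k] is at least half of [S n], which turns the tail bound [e / 2] into [e]. *)
have Sn2 : 2 * S k <= S n by near: n; exact: aoo.
have Sn1 : 1 <= S n by near: n; exact: aoo.
have Sn0 : 0 < S n by exact: lt_le_trans Sn1.
have m0 := running_min_ge0 n u0.
have Bn : B n <= sup (range B) by apply: sup_upper_bound => //; exists n.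
rewrite -/(S n) ger0_norm// gtr0_norm ?invr_gt0// ler_pdivlMr// mulrC.
have := BS n k kn.
have : (2 * S k) * running_min u n <= S n * running_min u n by rewrite ler_wpM2r.
by lra.
Unshelve. all: by end_near. Qed.

(** Once a partial sum reaches [A], positivity keeps the later ones above it; if none did, the
    series would be at most [A]. *)
Lemma near_sum_ge a A : (forall t, (0 < t)%N -> 0 < a t) ->
  (\sum_(1 <= t <oo) (a t)%:E = +oo)%E ->
  \forall n \near \oo, A <= \sum_(1 <= t < n.+1) a t.
Proof.
move=> a0 aoo; have [[k kA]|nA] := pselect (exists k, A <= \sum_(1 <= t < k.+1) a t).
  exists k => // n /= kn; apply: (le_trans kA).
  rewrite [leRHS](@big_cat_nat _ _ _ k.+1)//= lerDl.
  by rewrite big_nat sumr_ge0// => t /andP[kt _]; rewrite ltW// a0// (leq_ltn_trans _ kt).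
suff : (\sum_(1 <= t <oo) (a t)%:E <= A%:E)%E by rewrite aoo leye_eq.
apply: lime_le.
  by apply: is_cvg_nneseries => t t1 _; rewrite lee_fin ltW// a0.
exists 1%N => // -[//|n] _ /=; rewrite sumEFin lee_fin leNgt; apply/negP => An.
by apply: nA; exists n; exact: ltW.
Qed.

(** Integral comparison without integrals: the mean value theorem for the power [- p] bounds each
    term after the first by a telescoping difference. *)
Lemma sum_powR_le (p : R) n : 0 < p ->
  \sum_(1 <= t < n.+1) (t%:R `^ (1 + p))^-1 <= 1 + p^-1.
Proof.
move=> p0.
have step (t : nat) : (0 < t)%N ->
    (t.+1%:R `^ (1 + p))^-1 <= p^-1 * (t%:R `^ (- p) - t.+1%:R `^ (- p)).
  move=> t0; have tt : (t%:R : R) < t.+1%:R by rewrite ltr_nat.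
  have dpow (x : R) : x \in `]t%:R, t.+1%:R[%R ->
      is_derive x 1 (fun y : R => y `^ (- p)) (- p * x `^ (- p - 1)).
    rewrite in_itv/= => /andP[tx _]; apply: is_derive1_powR.
    by apply: lt_trans tx; rewrite ltr0n.
  have cpow : {within `[t%:R, t.+1%:R], continuous (fun y : R => y `^ (- p))}.
    apply: continuous_in_subspaceT => x; rewrite inE/= in_itv/= => /andP[tx _].
    have x0 : 0 < x by apply: lt_le_trans tx; rewrite ltr0n.
    apply/differentiable_continuous/derivable1_diffP.
    by have [] := @is_derive1_powR R (- p) x x0.
  have [c] := MVT tt dpow cpow.
  rewrite in_itv/= => /andP[tc ct] /eqP.
  rewrite -[in _ * (_ - _)]natr1 [_ + 1 - _]addrAC subrr add0r mulr1.
  rewrite -subr_eq0 => /eqP pE.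
  have c0 : 0 < c by apply: lt_trans tc; rewrite ltr0n.
  rewrite (_ : _ - _ = p * c `^ (- p - 1)); last by lra.
  rewrite mulKf ?gt_eqF// -opprD powRN lef_pV2 ?posrE ?powR_gt0// addrC.
  by rewrite ge0_ler_powR ?nnegrE ?addr_ge0 ?ltW.
have [->|n0] := posnP n.
  by rewrite big_geq// addr_ge0// invr_ge0 ltW.
(* The term at 1 contributes the summand [1]; the rest telescopes to at most [p^-1]. *)
rewrite big_ltn// powR1 invr1 lerD2l big_nat.
apply: (@le_trans _ _ (\sum_(2 <= t < n.+1) p^-1 * (t.-1%:R `^ (- p) - t%:R `^ (- p)))).
  by rewrite [leRHS]big_nat; apply: ler_sum => -[//|t] /andP[t1 _]; exact: step.
rewrite -mulr_sumr ler_piMr ?invr_ge0 ?(ltW p0)//.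
rewrite big_add1/= (eq_bigr (fun t : nat => - (t.+1%:R `^ (- p) - t%:R `^ (- p)))).
  rewrite sumrN telescope_sumr// powR1 opprB /= gerBl powR_ge0 //.
by move=> t _; rewrite opprB.
Qed.

(** Each of the [n] terms is at least the last one. *)
Lemma sum_powR_ge (p : R) n : (0 < n)%N -> 0 <= p ->
  n%:R `^ (1 - p) <= \sum_(1 <= t < n.+1) (t%:R `^ p)^-1.
Proof.
move=> n0 p0.
rewrite powRD ?pnatr_eq0 ?gtn_eqF// ?implybT// powRr1// powRN mulrC mulr_natr.
rewrite -[n in _ *+ n]subn0 -subSS -sumr_const_nat !big_nat.
apply: ler_sum => t /andP[t0 tn].
rewrite lef_pV2 ?posrE ?powR_gt0 ?ltr0n//.
by rewrite ge0_ler_powR ?nnegrE// ler_nat.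
Qed.

End running_minimum.

(** * Bounds in expectation and almost surely along the trajectory *)

Section stp.
Context {R : realType} {d : nat}.
Variables (f : 'rV[R]_d -> R) (L : R) (alpha : nat -> R).
Variables (D : probability (borel_rV R d) R).
Variables (dO : measure_display) (Omega : measurableType dO).
Variables (P : probability Omega R) (s : nat -> {RV P >-> borel_rV R d}).
Variable theta : nat -> Omega -> 'rV[R]_d.
Hypotheses (f_diff : forall x, differentiable f x) (f_smooth : smooth L f).
Hypothesis f_lb : has_lbound (range f).
Hypothesis D_sq : ('E_D[(fun u => enorm u ^+ 2)%R] < +oo)%E.
Hypothesis alpha_gt0 : forall t, (0 < t)%N -> 0 < alpha t.
Hypothesis alpha_sq : (\sum_(1 <= t <oo) (alpha t ^+ 2)%:E < +oo)%E.
Hypothesis stp : is_STP f alpha D s theta.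

Let M := (L ^+ 2 + 1) / 2.
(** A function of the pair, because Tonelli requires joint measurability. *)
Let abs_dotp (z : borel_rV R d * borel_rV R d) := `|dotp (grad f z.1) z.2|.

Let M_ge0 : 0 <= M.
Proof. by rewrite divr_ge0// addr_ge0// sqr_ge0. Qed.

Let abs_dotp_ge0 z : 0 <= abs_dotp z.
Proof. exact: normr_ge0. Qed.

Let measurable_abs_dotp :
  measurable_fun [set: borel_rV R d * borel_rV R d] abs_dotp.
Proof.
apply: measurableT_comp; first exact: normr_measurable.
apply: measurable_sum => i; apply: measurable_funM.
  apply: (measurableT_comp (f := fun x : borel_rV R d => grad f x ord0 i)) => //.
  by apply: measurable_borel_rV; exact: continuous_grad_coord f_smooth.
apply: (measurableT_comp (f := fun x : borel_rV R d => x ord0 i)) => //.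
by apply: measurable_borel_rV; exact: coord_continuous.
Qed.

Let measurable_sqr_enorm :
  measurable_fun [set: borel_rV R d] (fun u : borel_rV R d => enorm u ^+ 2).
Proof. by apply: measurable_borel_rV; exact: continuous_sqr_enorm. Qed.

(** Sums the one-step decrease along each path, before any expectation is taken. *)
Lemma stp_telescope w n :
  \sum_(1 <= t < n.+1) alpha t * abs_dotp (theta t w, s t w) + f (theta n.+1 w) <=
  f (theta 1%N w) + M * \sum_(1 <= t < n.+1) alpha t ^+ 2 * enorm (s t w) ^+ 2.
Proof.
have [step [_ amin thetaS]] := STP_step stp.
elim: n => [|n IH]; first by rewrite !big_geq// mulr0 addr0 add0r.
rewrite !(big_nat_recr n.+1)//= mulrDr.
have := argmin_descent f_diff f_smooth (ltW (alpha_gt0 (ltn0Sn n)))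
  (amin n.+1 (theta n.+1 w) (s n.+1 w) isT).
rewrite -thetaS// -/M /abs_dotp/=; move: IH; lra.
Qed.

(** At [theta t w] this stands in for the conditional expectation, given the past, of the absolute
    inner product of the gradient with [s t]. *)
Let E_abs (x : borel_rV R d) := ('E_D[(fun u => `|dotp (grad f x) u|)%R])%E.
Local Open Scope ereal_scope.

Let E_absE x : E_abs x = \int[D]_u (abs_dotp (x, u))%:E.
Proof. by rewrite /E_abs unlock. Qed.

Let E_abs_ge0 x : 0 <= E_abs x.
Proof. by rewrite E_absE; apply: integral_ge0 => u _; rewrite lee_fin. Qed.

Let measurable_theta t : (0 < t)%N ->
  measurable_fun [set: Omega] (theta t : Omega -> borel_rV R d).
Proof.
move=> t0; have [step [mstep _ thetaS]] := STP_step stp.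
exact: (measurable_iterate mstep (STP_init stp) thetaS t0).
Qed.

Let measurable_E_abs_theta t : (0 < t)%N ->
  measurable_fun [set: Omega] (fun w => (alpha t)%:E * E_abs (theta t w)).
Proof.
move=> t0; apply: measurable_funeM.
apply: (measurableT_comp (f := E_abs)); last exact: measurable_theta.
rewrite (_ : E_abs = fun x => \int[D]_u (EFin \o abs_dotp) (x, u)); last first.
  by apply/funext => x; rewrite E_absE.
apply: measurable_fun_fubini_tonelli_F; first exact/measurable_EFinP.
by move=> z; rewrite /= lee_fin.
Qed.

Lemma integral_stp_step t : (0 < t)%N ->
  \int[P]_w ((alpha t)%:E * E_abs (theta t w)) =
  \int[P]_w (alpha t * abs_dotp (theta t w, s t w))%:E.
Proof.
move=> t0; have [step [mstep _ thetaS]] := STP_step stp.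
rewrite (integral_iterate_step (STP_law stp) (STP_indep stp) mstep (STP_init stp)
  thetaS (phi := fun z => (alpha t * abs_dotp z)%:E) t0).
- apply: eq_integral => w _; rewrite E_absE.
  under [RHS]eq_integral do rewrite EFinM.
  rewrite ge0_integralZl_EFin//; last exact: ltW (alpha_gt0 t0).
    by move=> u _; rewrite lee_fin.
  by apply/measurable_EFinP; exact: measurableT_comp.
- by apply/measurable_EFinP; apply: measurable_funM.
- by move=> z; rewrite lee_fin mulr_ge0// ltW// alpha_gt0.
Qed.

Lemma integral_sqr_enorm t : (0 < t)%N ->
  \int[P]_w (enorm (s t w) ^+ 2)%:E = 'E_D[(fun u => enorm u ^+ 2)%R].
Proof.
move=> t0; rewrite unlock.
transitivity (\int[distribution P (s t)]_u (enorm u ^+ 2)%:E).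
  rewrite ge0_integral_distribution//; first exact/measurable_EFinP.
  by move=> y; rewrite lee_fin sqr_ge0.
by apply: eq_measure_integral => A mA _; exact: (STP_law stp t0).
Qed.

(** Integrates the pathwise telescoped bound, after [integral_stp_step] has put the actual direction
    back in place of the averaged one. *)
Lemma sum_E_abs_bounded : exists C : R, forall n,
  \sum_(1 <= t < n.+1) \int[P]_w ((alpha t)%:E * E_abs (theta t w)) <= C%:E.
Proof.
have [lb flb] := f_lb.
have {}flb x : (lb <= f x)%R by apply: flb; exists x.
have [x0 x0E] := STP_init stp.
have K0 : 0 <= 'E_D[(fun u => enorm u ^+ 2)%R].
  by apply: expectation_ge0 => u; exact: sqr_ge0.
have [K KE] : exists K : R, 'E_D[(fun u => enorm u ^+ 2)%R] = K%:E.
  by exists (fine 'E_D[(fun u => enorm u ^+ 2)%R]); rewrite fineK// ge0_fin_numE.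
rewrite KE lee_fin in K0.
have [A AE] : exists A : R, forall n, (\sum_(1 <= t < n.+1) alpha t ^+ 2 <= A)%R.
  exists (fine (\sum_(1 <= t <oo) (alpha t ^+ 2)%:E)) => n.
  rewrite -lee_fin fineK; last first.
    by rewrite ge0_fin_numE// nneseries_ge0// => t _ _; rewrite lee_fin sqr_ge0.
  rewrite -sumEFin; apply: nneseries_lim_ge => t _ _.
  by rewrite lee_fin sqr_ge0.
(* [f x0 - lb] bounds the total decrease of [f], [K] is the second moment of [D], and [A] bounds the
   sums of squared step sizes. *)
exists ((f x0 - lb) + M * (K * A))%R => n.
pose X t w := (alpha t ^+ 2 * enorm (s t w) ^+ 2)%R.
have X0 t w : (0 <= X t w)%R by rewrite mulr_ge0// sqr_ge0.
have mX t : measurable_fun [set: Omega] (X t).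
  apply: measurable_funM => //.
  exact: (measurableT_comp measurable_sqr_enorm (measurable_funPT (s t))).
have aG t w : (0 < t)%N -> (0 <= alpha t * abs_dotp (theta t w, s t w))%R.
  by move=> t0; rewrite mulr_ge0// ltW// alpha_gt0.
have mG t : (0 < t)%N ->
    measurable_fun [set: Omega] (fun w => alpha t * abs_dotp (theta t w, s t w))%R.
  move=> t0; apply: measurable_funM => //.
  apply: (measurableT_comp measurable_abs_dotp).
  by apply: measurable_fun_pair => //; exact: measurable_theta.
rewrite big_nat (eq_bigr _ (fun t tn => integral_stp_step (andP tn).1)).
(* After the shift to [t.+1], every index is a positive time, as the termwise side conditions on
   measurability and sign require. *)
rewrite -big_nat big_add1/=.
rewrite -ge0_integral_sum//; last 2 first.
- by move=> t; exact/measurable_EFinP/mG.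
- by move=> t w _; rewrite lee_fin aG.
apply: (@le_trans _ _ (\int[P]_w ((f x0 - lb)%:E +
    \sum_(0 <= t < n) M%:E * (X t.+1 w)%:E))).
  apply: ge0_le_integral => //.
  - by move=> w _; rewrite sume_ge0// => t _; rewrite lee_fin aG.
  - by apply: emeasurable_sum => t; exact/measurable_EFinP/mG.
  - apply: emeasurable_funD => //; apply: emeasurable_sum => t.
    by apply: measurable_funeM; exact/measurable_EFinP.
  - move=> w _; have := stp_telescope w n; rewrite x0E !big_add1/=.
    rewrite -ge0_sume_distrr; last by move=> t _; rewrite lee_fin.
    rewrite !sumEFin -EFinM -EFinD lee_fin.
    by have := flb (theta n.+1 w); rewrite /X; lra.
rewrite ge0_integralD//; last 3 first.
- by move=> w _; rewrite lee_fin subr_ge0.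
- by move=> w _; apply: sume_ge0 => t _; rewrite mule_ge0// lee_fin.
- by apply: emeasurable_sum => t; apply: measurable_funeM; exact/measurable_EFinP.
rewrite integral_cst// [X in _ * X](_ : _ = 1) ?mule1; last exact: probability_setT.
rewrite ge0_integral_sum//; last 2 first.
- by move=> t; apply: measurable_funeM; exact/measurable_EFinP.
- by move=> t w _; rewrite mule_ge0// lee_fin.
rewrite [leRHS]EFinD; apply: leeD2l.
rewrite (eq_bigr (fun t => M%:E * (K * alpha t.+1 ^+ 2)%:E)); last first.
  move=> t _; rewrite ge0_integralZl_EFin//; last 2 first.
  - by move=> w _; rewrite lee_fin.
  - exact/measurable_EFinP.
  congr (_ * _); under eq_integral do rewrite EFinM.
  rewrite ge0_integralZl_EFin ?sqr_ge0//; [|by move=> w _; rewrite lee_fin sqr_ge0|].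
    by rewrite integral_sqr_enorm// KE muleC.
  apply/measurable_EFinP.
  exact: (measurableT_comp measurable_sqr_enorm (measurable_funPT (s t.+1))).
rewrite -ge0_sume_distrr; last first.
  by move=> t _; rewrite lee_fin mulr_ge0// sqr_ge0.
rewrite sumEFin -EFinM lee_fin ler_wpM2l// -mulr_sumr ler_wpM2l//.
by have := AE n; rewrite big_add1.
Qed.

(** Exchanging series and integral shows that the full series has finite integral, hence is finite
    almost everywhere; its value bounds all partial sums. *)
Lemma ae_sum_E_abs_bounded : \forall w \ae P, exists C : R, forall n,
  \sum_(1 <= t < n.+1) (alpha t)%:E * E_abs (theta t w) <= C%:E.
Proof.
have [C sumC] := sum_E_abs_bounded.
pose psi t w := (alpha t.+1)%:E * E_abs (theta t.+1 w).
have psi0 t w : 0 <= psi t w by rewrite mule_ge0// lee_fin ltW// alpha_gt0.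
have mpsi t : measurable_fun [set: Omega] (psi t) by exact: measurable_E_abs_theta.
have intpsi : P.-integrable [set: Omega] (fun w => \sum_(t <oo) psi t w).
  apply/integrableP; split; first exact: ge0_emeasurable_sum.
  under eq_integral do rewrite gee0_abs ?nneseries_ge0//.
  rewrite integral_nneseries//; apply: le_lt_trans (ltry C).
  apply: lime_le; first by apply: is_cvg_nneseries => t _ _; exact: integral_ge0.
  by apply: nearW => n; have := sumC n; rewrite big_add1.
apply: filterS (integrable_ae measurableT intpsi) => w /(_ I) fin.
exists (fine (\sum_(t <oo) psi t w)) => n; rewrite fineK// big_add1.
by apply: (@nneseries_lim_ge _ (psi^~ w) xpredT 0 n) => t _ _; exact: psi0.
Qed.

End stp.

(** * The almost sure rates, for general and for polynomial step sizes *)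

Theorem theorem1 (R : realType) (d : nat) (f : 'rV[R]_d -> R) (L : R)
    (D : probability (borel_rV R d) R) (N : 'rV[R]_d -> R) (muD : R)
    (dO : measure_display) (Omega : measurableType dO)
    (P : probability Omega R) (s : nat -> {RV P >-> borel_rV R d})
    (theta : nat -> Omega -> 'rV[R]_d)
    (f_diff : forall x, differentiable f x)
    (f_lb : has_lbound (range f))
    (f_smooth : smooth L f)
    (D_sq : ('E_D[(fun u => enorm u ^+ 2)%R] < +oo)%E)
    (N_norm : is_norm N)
    (muD_gt0 : 0 < muD)
    (D_lb : forall v : 'rV[R]_d,
      ((muD * N v)%:E <= 'E_D[(fun u => `|dotp v u|)%R])%E)
    (D_ball : D [set u | enorm u <= 1] = 1%E) :
  (forall alpha : nat -> R,
     (forall t, (0 < t)%N -> 0 < alpha t) ->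
     (\sum_(1 <= t <oo) (alpha t ^+ 2)%:E < +oo)%E ->
     (\sum_(1 <= t <oo) (alpha t)%:E = +oo)%E ->
     is_STP f alpha D s theta ->
     \forall w \ae P,
       running_min (fun t => N (grad f (theta t w)))
         =o_\oo (fun T => (\sum_(1 <= t < T.+1) alpha t)^-1)) /\
  (forall a eps : R, 0 < a -> 0 < eps < 2^-1 ->
     is_STP f (fun t => a / t%:R `^ (2^-1 + eps)) D s theta ->
     \forall w \ae P,
       running_min (fun t => N (grad f (theta t w)))
         =o_\oo (fun T => (T%:R `^ (2^-1 - eps))^-1)).
Proof.
(* The triangle inequality for [x] and [- x] gives [0 <= 2 * N x]. *)
have N0 x : 0 <= N x.
  have Nzero : N 0 = 0 by rewrite -(scale0r 0) (is_norm_scale N_norm) normr0 mul0r.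
  have := is_norm_triangle N_norm x (- x).
  rewrite subrr Nzero -scaleN1r (is_norm_scale N_norm) normrN1 mul1r.
  lra.
have rate alpha : (forall t, (0 < t)%N -> 0 < alpha t) ->
    (\sum_(1 <= t <oo) (alpha t ^+ 2)%:E < +oo)%E ->
    (forall A, \forall n \near \oo, A <= \sum_(1 <= t < n.+1) alpha t) ->
    is_STP f alpha D s theta ->
    \forall w \ae P, running_min (fun t => N (grad f (theta t w)))
      =o_\oo (fun T => (\sum_(1 <= t < T.+1) alpha t)^-1).
  move=> alpha0 alpha_sq alphaoo stp.
  have := ae_sum_E_abs_bounded f_diff f_smooth f_lb D_sq alpha0 alpha_sq stp.
  apply: filterS => w [C sumC].
  (* Dividing by [muD] passes from the averaged inner products to [N] of the gradients, by
     [D_lb]. *)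
  apply: (running_min_littleo (C := C / muD)) => // n.
  rewrite ler_pdivlMr// mulr_suml -lee_fin -sumEFin; apply: le_trans (sumC n).
  rewrite !big_nat; apply: lee_sum => t /andP[t0 _].
  rewrite -mulrA EFinM; apply: lee_wpmul2l; first by rewrite lee_fin ltW// alpha0.
  by rewrite mulrC.
split=> [alpha alpha0 alpha_sq alphaoo|a eps a0 /andP[e0 e12] stp].
  by apply: rate => // A; exact: near_sum_ge.
(* The range of [eps] serves twice: [1 - p > 0] makes the step sizes sum to infinity, and
   [2 * p = 1 + 2 * eps > 1] makes their squares summable. *)
pose p : R := 2^-1 + eps; pose alpha t : R := a / t%:R `^ p.
have p0 : 0 < p by rewrite addr_gt0.
have alpha0 t : (0 < t)%N -> 0 < alpha t.
  by move=> t0; rewrite divr_gt0 ?powR_gt0 ?ltr0n.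
have sumE n : \sum_(1 <= t < n.+1) alpha t = a * \sum_(1 <= t < n.+1) (t%:R `^ p)^-1.
  by rewrite mulr_sumr.
have pE : 1 - p = 2^-1 - eps by rewrite /p; lra.
have q0 : 0 < 2^-1 - eps by rewrite subr_gt0.
have sum_ge n : (0 < n)%N -> a * n%:R `^ (2^-1 - eps) <= \sum_(1 <= t < n.+1) alpha t.
  by move=> n0; rewrite sumE ler_wpM2l ?(ltW a0)// -pE sum_powR_ge// ltW.
have alphaoo A : \forall n \near \oo, A <= \sum_(1 <= t < n.+1) alpha t.
  (* Chosen so that [B] to the power [2^-1 - eps] is [|A| / a]. *)
  pose B := (`|A| / a) `^ (2^-1 - eps)^-1.
  near=> n.
  have n0 : (0 < n)%N by near: n; exact: nbhs_infty_gt.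
  apply: le_trans (sum_ge n n0); rewrite mulrC -ler_pdivrMr//.
  apply: (@le_trans _ _ (B `^ (2^-1 - eps))).
    rewrite /B -powRrM mulVf ?gt_eqF// powRr1 ?divr_ge0// ?(ltW a0)//.
    by rewrite ler_pM2r ?invr_gt0// ler_norm.
  rewrite ge0_ler_powR ?nnegrE ?powR_ge0 ?(ltW q0)//.
  by near: n; exact: nbhs_infty_ger.
have alpha_sq : (\sum_(1 <= t <oo) (alpha t ^+ 2)%:E < +oo)%E.
  apply: (@le_lt_trans _ _ (a ^+ 2 * (1 + (2 * eps)^-1))%:E); last exact: ltry.
  apply: lime_le.
    by apply: is_cvg_nneseries => t _ _; rewrite lee_fin sqr_ge0.
  exists 1%N => // -[//|n] _ /=; rewrite sumEFin lee_fin.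
  rewrite (eq_bigr (fun t : nat => a ^+ 2 * (t%:R `^ (1 + 2 * eps))^-1)); last first.
    move=> t _; rewrite /alpha exprMn exprVn.
    rewrite -[(_ `^ _) ^+ 2]powR_mulrn ?powR_ge0// -powRrM.
    by congr (_ * (_ `^ _)^-1); rewrite /p; lra.
  rewrite -mulr_sumr ler_wpM2l ?sqr_ge0//.
  by apply: sum_powR_le; rewrite mulr_gt0.
have := rate alpha alpha0 alpha_sq alphaoo stp.
apply: filterS => w /eqoP rmin; apply/eqoP => e e0'.
(* The general rate is used with tolerance [e * a]: the sum of step sizes is at least [a] times the
   target power of [n], and this factor cancels. *)
have ea0 : 0 < e * a by rewrite mulr_gt0.
near=> n.
have n0 : (0 < n)%N by near: n; exact: nbhs_infty_gt.
have nq0 : 0 < n%:R `^ (2^-1 - eps) :> R by rewrite powR_gt0 ?ltr0n.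
have S0 : 0 < \sum_(1 <= t < n.+1) alpha t.
  by apply: lt_le_trans (sum_ge n n0); rewrite mulr_gt0.
apply: (@le_trans _ _ (e * a * `|(\sum_(1 <= t < n.+1) alpha t)^-1|)).
  by near: n; exact: rmin.
rewrite !gtr0_norm ?invr_gt0// -mulrA ler_pM2l// ler_pdivrMr// mulrC.
by rewrite ler_pdivlMr// sum_ge.
Unshelve. all: by end_near. Qed.
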